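(* For $p\in\{120,101\}$, we have $$C_p(x,y)=\frac{1-2x+x^2-x^2y}{1-3x+2x^2-x^2y}.$$
   Context: A Catalan word of length $n\geq 1$ is a word $w_1\ldots w_n$ over the non-negative integers with $w_1=0$ and $0\leq w_i\leq w_{i-1}+1$ for $2\leq i\leq n$; the empty word is the unique Catalan word of length $0$. A word $w$ contains the pattern $p=p_1\ldots p_k$ if there are indices $i_1<\cdots<i_k$ such that $w_{i_1}\ldots w_{i_k}$ is order-isomorphic to $p$ (for all $a,b$: $w_{i_a}<w_{i_b}$ iff $p_a<p_b$, and $w_{i_a}=w_{i_b}$ iff $p_a=p_b$); otherwise $w$ avoids $p$. $\mathcal{C}_n(p)$ is the set of Catalan words of length $n$ avoiding $p$. A descent of $w$ is an index $i$ with $w_i>w_{i+1}$. $C_p(x,y)=\sum_{n,k\geq 0}c_{n,k}x^ny^k$, where $c_{n,k}$ is the number of words in $\mathcal{C}_n(p)$ with exactly $k$ descents. *)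

(* Defs.v *)
From HB Require Import structures.
From mathcomp Require Import all_boot all_order all_algebra.
From mathcomp Require Import boolp.

Set Implicit Arguments.
Unset Strict Implicit.
Unset Printing Implicit Defensive.

Import GRing.Theory.
Local Open Scope ring_scope.

(* Formal power series in one variable over a commutative ring R with units.
   They form again a commutative ring with units (the units being the series
   whose constant coefficient is a unit of R), so that the construction can be
   iterated: R[[x, y]] is R[[y]][[x]], i.e., fps (fps R). *)
Record fps (R : Type) := Fps { fps_coef : nat -> R }.

Section FpsRing.
Variable R : comUnitRingType.
Implicit Types f g h : fps R.

Lemma fpsP f g : fps_coef f =1 fps_coef g <-> f = g.
Proof. by case: f g => [f] [g]; split=> [/= /funext -> | [->]]. Qed.

Lemma fps_coefK : cancel (@fps_coef R) (@Fps R).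
Proof. by case. Qed.

HB.instance Definition _ := Choice.copy (fps R) (can_type fps_coefK).

Definition fps_zero : fps R := Fps (fun=> 0).
Definition fps_opp f := Fps (fun n => - fps_coef f n).
Definition fps_add f g := Fps (fun n => fps_coef f n + fps_coef g n).

Fact fps_addA : associative fps_add.
Proof. by move=> f g h; apply/fpsP => n; apply: addrA. Qed.
Fact fps_addC : commutative fps_add.
Proof. by move=> f g; apply/fpsP => n; apply: addrC. Qed.
Fact fps_add0 : left_id fps_zero fps_add.
Proof. by move=> f; apply/fpsP => n; apply: add0r. Qed.
Fact fps_addN : left_inverse fps_zero fps_opp fps_add.
Proof. by move=> f; apply/fpsP => n; apply: addNr. Qed.

HB.instance Definition _ :=
  GRing.isZmodule.Build (fps R) fps_addA fps_addC fps_add0 fps_addN.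

Definition fpsC (c : R) : fps R := Fps (fun n => if n == 0%N then c else 0).
Definition fpsX : fps R := Fps (fun n => (n == 1%N)%:R).
Definition fps_mul f g : fps R :=
  Fps (fun n => \sum_(j < n.+1) fps_coef f j * fps_coef g (n - j)%N).

Let trunc n f : {poly R} := \poly_(i < n.+1) fps_coef f i.

Let coef_trunc n f i : (i <= n)%N -> (trunc n f)`_i = fps_coef f i.
Proof. by move=> le_in; rewrite coef_poly ltnS le_in. Qed.

Let coef_mul_trunc n f g i : (i <= n)%N ->
  fps_coef (fps_mul f g) i = (trunc n f * trunc n g)`_i.
Proof.
move=> le_in; rewrite coefM; apply: eq_bigr => j _.
have le_jn : (j <= n)%N by apply: leq_trans le_in; rewrite -ltnS.
by rewrite !coef_trunc // (leq_trans (leq_subr j i)).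
Qed.

Fact fps_mulC : commutative fps_mul.
Proof. by move=> f g; apply/fpsP => n; rewrite !(@coef_mul_trunc n) // mulrC. Qed.

Fact fps_mulA : associative fps_mul.
Proof.
move=> f g h; apply/fpsP => n.
transitivity (trunc n f * (trunc n g * trunc n h))`_n.
  rewrite coefM; apply: eq_bigr => j _.
  by rewrite coef_trunc ?leq_ord // (@coef_mul_trunc n) ?leq_subr.
rewrite mulrA coefM; apply: eq_bigr => j _.
by rewrite coef_trunc ?leq_subr // (@coef_mul_trunc n) // leq_ord.
Qed.

Fact fps_mul1 : left_id (fpsC 1) fps_mul.
Proof.
move=> f; apply/fpsP => n /=.
rewrite big_ord_recl /= mul1r subn0 big1 ?addr0 // => j _.
by rewrite mul0r.
Qed.

Fact fps_mulDl : left_distributive fps_mul fps_add.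
Proof.
move=> f g h; apply/fpsP => n /=; rewrite -big_split.
by apply: eq_bigr => j _; rewrite mulrDl.
Qed.

Fact fps_one_neq0 : fpsC 1 != 0.
Proof. by apply/eqP => -[] /(congr1 (@^~ 0%N))/eqP; rewrite oner_eq0. Qed.

HB.instance Definition _ := GRing.Zmodule_isComNzRing.Build (fps R)
  fps_mulA fps_mulC fps_mul1 fps_mulDl fps_one_neq0.

(* The list of the first n.+1 coefficients of f^-1, obtained by solving
   f * f^-1 = 1 one degree at a time. *)
Fixpoint fps_inv_seq f n : seq R :=
  if n is m.+1 then
    let s := fps_inv_seq f m in
    rcons s (- (fps_coef f 0)^-1 * \sum_(j < m.+1) s`_j * fps_coef f (m.+1 - j)%N)
  else [:: (fps_coef f 0)^-1].

Definition fps_unit : {pred fps R} := fun f => fps_coef f 0 \is a GRing.unit.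

Definition fps_inv f : fps R :=
  if fps_unit f then Fps (fun n => (fps_inv_seq f n)`_n) else f.

Let size_inv_seq f n : size (fps_inv_seq f n) = n.+1.
Proof. by elim: n => //= n IHn; rewrite size_rcons IHn. Qed.

Let nth_inv_seq f n i : (i <= n)%N -> (fps_inv_seq f n)`_i = (fps_inv_seq f i)`_i.
Proof.
elim: n => [|n IHn]; first by rewrite leqn0 => /eqP ->.
rewrite leq_eqVlt => /predU1P[-> // | lt_in] /=.
by rewrite nth_rcons size_inv_seq lt_in IHn.
Qed.

Fact fps_mulV : {in fps_unit, left_inverse 1 fps_inv *%R}.
Proof.
move=> f Uf; apply/fpsP => n; rewrite /fps_inv [fps_unit f]Uf.
case: n => [|n]; first by rewrite /= big_ord1 mulVr.
rewrite [LHS]/= big_ord_recr /= subnn nth_rcons size_inv_seq ltnn eqxx.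
rewrite mulrAC !mulNr mulVr // mul1r; apply/eqP; rewrite subr_eq0; apply/eqP.
by apply: eq_bigr => j _; rewrite [in RHS]nth_inv_seq // -ltnS.
Qed.

Fact fps_unitPl f g : g * f = 1 -> fps_unit f.
Proof.
move/fpsP/(_ 0%N); rewrite /= big_ord1 => gf1.
by apply/unitrPr; exists (fps_coef g 0); rewrite mulrC.
Qed.

Fact fps_inv_out : {in [predC fps_unit], fps_inv =1 id}.
Proof. by move=> f /negbTE nUf; rewrite /fps_inv [fps_unit f]nUf. Qed.

HB.instance Definition _ := GRing.ComNzRing_hasMulInverse.Build (fps R)
  fps_mulV fps_unitPl fps_inv_out.

End FpsRing.

Arguments fpsX {R}.

Notation fps2 := (fps (fps int)).
Definition fps2x : fps2 := fpsX.
Definition fps2y : fps2 := fpsC fpsX.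

Local Open Scope nat_scope.

Definition is_catalan (w : seq nat) : bool :=
  if w is a :: s then (a == 0) && path (fun u v => v <= u.+1) a s else true.

Definition contains (p w : seq nat) : bool :=
  [exists i : {ffun 'I_(size p) -> 'I_(size w)},
    [forall a : 'I_(size p), forall b : 'I_(size p),
      (a < b) ==> (i a < i b)] &&
    [forall a : 'I_(size p), forall b : 'I_(size p),
      ((nth 0 w (i a) < nth 0 w (i b)) == (nth 0 p a < nth 0 p b)) &&
      ((nth 0 w (i a) == nth 0 w (i b)) == (nth 0 p a == nth 0 p b))]].

Definition avoids (p w : seq nat) : bool := ~~ contains p w.

Definition descents (w : seq nat) : nat :=
  #|[set i : 'I_(size w).-1 | nth 0 w i > nth 0 w i.+1]|.

Lemma catalan_letter_bound (w : seq nat) :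
  is_catalan w -> all (fun a => a < size w) w.
Proof.
case: w => //= _ s /andP[/eqP-> Hs] /=; apply/allP => b.
suff H: forall a t, path (fun u v => v <= u.+1) a t -> {in t, forall c, c <= a + size t}.
  by move/(H 0 s Hs).
move=> a t; elim: t a => //= c t IHt a /andP[le_ca /IHt Ht] d.
rewrite inE => /predU1P[->|/Ht le_d].
  by rewrite (leq_trans le_ca) // addnS ltnS leq_addr.
by rewrite (leq_trans le_d) // addnS -addSn leq_add2r.
Qed.

(* A Catalan word of length n only has letters smaller than n (see
   catalan_letter_bound), hence is a tuple over 'I_n. *)
Definition word_of n (w : n.-tuple 'I_n) : seq nat := [seq val a | a <- w].

Definition catalan_avoiding (p : seq nat) (n : nat) : {set n.-tuple 'I_n} :=
  [set w | is_catalan (word_of w) && avoids p (word_of w)].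

Definition catalan_count (p : seq nat) (n k : nat) : nat :=
  #|[set w in catalan_avoiding p n | descents (word_of w) == k]|.

Definition catalan_gf (p : seq nat) : fps2 :=
  Fps (fun n => Fps (fun k => (catalan_count p n k)%:Z)).

(* Main.v *)
Require Import Defs.
From HB Require Import structures.
From mathcomp Require Import all_boot all_order all_algebra.
From mathcomp Require Import zify ring.

(** By the discrete intermediate value property of Catalan words, such a word
    avoids 120 iff no letter is followed, at any distance, by a letter smaller by
    at least 2, and avoids 101 iff it is unimodal. Both classes can therefore be
    read by an automaton that remembers the last letter together with a lower
    bound on the next letters (120), or with a flag telling whether a descent has
    occurred (101). Let [Z n] and [T n] enumerate by descents the continuations of
    length [n] of the words 0 and 01. In both cases
      [Z (n+1) = Z n + T n]   and   [T (n+1) = 2 T n + y Z n],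
    whence the generating function [1 + x Z]. For 120 this holds because the
    number of continuations depends only on the difference between the last letter
    and the lower bound. For 101, let [A m n] count the continuations of length
    [n] of 01..m; then
      [A (m+1) (n+1) - A (m+1) n = A m (n+1) - A m n + y A m n]. *)

Import GRing.Theory.

Local Open Scope ring_scope.

(** * Coefficients and units of formal power series *)

Lemma fps_coef_sum (R : comUnitRingType) (I : Type) (r : seq I) (F : I -> fps R) k :
  fps_coef (\sum_(i <- r) F i) k = \sum_(i <- r) fps_coef (F i) k.
Proof. by elim/big_rec2: _ => // i x y _ <-. Qed.

Lemma fps_coef_mulX (R : comUnitRingType) (f : fps R) k :
  fps_coef (fpsX * f) k = if k is k'.+1 then fps_coef f k' else 0.
Proof.
case: k => [|k] /=; first by rewrite big_ord1 mul0r.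
rewrite big_ord_recl mul0r add0r big_ord_recl /= mul1r subn1 big1 ?addr0 //.
by move=> i _; rewrite mul0r.
Qed.

Lemma fps_coefXn (R : comUnitRingType) d k :
  fps_coef (fpsX ^+ d : fps R) k = (d == k)%:R.
Proof.
elim: d k => [|d IHd] k; first by case: k.
by rewrite exprS fps_coef_mulX; case: k.
Qed.

Lemma fps_shift (R : comUnitRingType) (f : fps R) :
  f = fpsC (fps_coef f 0) + fpsX * Fps (fun n => fps_coef f n.+1).
Proof.
apply/fpsP => k; rewrite -[RHS]/(fps_coef (fpsC _) k + fps_coef (_ * _) k).
by rewrite fps_coef_mulX; case: k => [|k] /=; rewrite ?addr0 ?add0r.
Qed.

Lemma fps_coef_mulC (R : comUnitRingType) (c : R) (f : fps R) k :
  fps_coef (fpsC c * f) k = c * fps_coef f k.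
Proof.
by rewrite /= big_ord_recl /= subn0 big1 ?addr0 // => i _; rewrite mul0r.
Qed.

Lemma fps_unit_1Xl (R : comUnitRingType) (f : fps R) :
  1 + fpsX * f \is a GRing.unit.
Proof.
suff: fps_coef (1 + fpsX * f) 0 = 1.
  by rewrite -[_ \is a _]/(fps_coef _ 0 \is a GRing.unit) => ->; apply: unitr1.
by rewrite -[LHS]/(1 + fps_coef (fpsX * f) 0) fps_coef_mulX addr0.
Qed.

Local Open Scope nat_scope.

(** * Avoidance of 120 and 101 by Catalan words *)

Fixpoint triplewise (P : nat -> nat -> nat -> bool) (s : seq nat) : bool :=
  if s is a :: s' then pairwise (P a) s' && triplewise P s' else true.

Lemma triplewiseP (P : nat -> nat -> nat -> bool) (s : seq nat) :
  reflect (forall i j k, i < j -> j < k -> k < size s ->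
             P (nth 0 s i) (nth 0 s j) (nth 0 s k))
          (triplewise P s).
Proof.
elim: s => [|a s IHs] /=; first by left.
apply: (iffP andP) => [[/(pairwiseP 0) Pa /IHs Ps]|Ps].
  move=> [|i] [|j] [|k] //= ij jk ks; last by apply: Ps.
  by apply: Pa => //; rewrite inE; lia.
split; last by apply/IHs => i j k ij jk ks; apply: (Ps i.+1 j.+1 k.+1).
by apply/(pairwiseP 0) => j k _; rewrite inE => ks jk; apply: (Ps 0 j.+1 k.+1).
Qed.

Definition same_order (a b c d : nat) : bool :=
  ((a < b) == (c < d)) && ((a == b) == (c == d)).

(** Three comparisons suffice for order-isomorphism: the diagonal ones are trivial and the reversed
    ones follow. *)
Lemma avoids3 (p0 p1 p2 : nat) (w : seq nat) :
  avoids [:: p0; p1; p2] w =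
  triplewise (fun a b c => ~~ [&& same_order a b p0 p1, same_order a c p0 p2 &
                                  same_order b c p1 p2]) w.
Proof.
rewrite /avoids; apply/idP/idP.
  apply: contraNT => /triplewiseP nP; apply/existsP.
  have [i [j [k [ij jk ks ijk]]]] : exists i j k, [/\ i < j, j < k, k < size w &
     [&& same_order (nth 0 w i) (nth 0 w j) p0 p1,
         same_order (nth 0 w i) (nth 0 w k) p0 p2 &
         same_order (nth 0 w j) (nth 0 w k) p1 p2]].
    apply: boolp.contrapT => nE; apply: nP => i j k ij jk ks; apply/negP => ijk.
    by apply: nE; exists i, j, k.
  have js := ltn_trans jk ks; have is_ := ltn_trans ij js.
  exists [ffun a : 'I_3 => nth (Ordinal ks)
    [:: Ordinal is_; Ordinal js; Ordinal ks] a] => /=.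
  move: ijk; rewrite /same_order => ijk.
  apply/andP; split; apply/forallP => -[[|[|[|a]]] // ha];
    apply/forallP => -[[|[|[|b]]] // hb]; rewrite !ffunE /= ?ltnn ?eqxx //; lia.
move=> /triplewiseP Pw; apply/negP => /existsP[f /andP[/forallP fI /forallP fO]].
pose o0 : 'I_3 := @Ordinal 3 0 isT; pose o1 : 'I_3 := @Ordinal 3 1 isT.
pose o2 : 'I_3 := @Ordinal 3 2 isT.
have f01 : f o0 < f o1 by move/forallP/(_ o1): (fI o0).
have f12 : f o1 < f o2 by move/forallP/(_ o2): (fI o1).
move/negP: (Pw _ _ _ f01 f12 (ltn_ord (f o2))); apply.
by apply/and3P; split; [move/forallP/(_ o1): (fO o0) | move/forallP/(_ o2): (fO o0)
  | move/forallP/(_ o2): (fO o1)].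
Qed.

Lemma catalan_step (w : seq nat) i :
  is_catalan w -> i.+1 < size w -> nth 0 w i.+1 <= (nth 0 w i).+1.
Proof.
by case: w => //= a s /andP[_ /(pathP 0) as_] /=; rewrite ltnS => /as_.
Qed.

Lemma catalan_nth0 (w : seq nat) : is_catalan w -> nth 0 w 0 = 0.
Proof. by case: w => //= a s /andP[/eqP]. Qed.

(** Letters rise by at most 1 per step: if the last letter exceeds [b], the one before it is still
    at least [b], which allows induction on [k]. *)
Lemma catalan_ivt (w : seq nat) (i k b : nat) :
  is_catalan w -> i <= k -> k < size w -> nth 0 w i <= b <= nth 0 w k ->
  exists2 h, i <= h <= k & nth 0 w h = b.
Proof.
move=> wC; elim: k => [|k IHk] ik ks /andP[ib bk].
  by move: ik ib; rewrite leqn0 => /eqP -> ib; exists 0 => //; lia.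
have [kb|kb] := eqVneq (nth 0 w k.+1) b; first by exists k.+1; rewrite ?ik /=.
have [ik1|ik1] := eqVneq i k.+1; first by move: ib; rewrite ik1; lia.
have wk := catalan_step _ _ wC ks.
have [|||h hk <-] := IHk; [lia|lia|lia|]; exists h => //; lia.
Qed.

Lemma catalan_avoids120 (w : seq nat) : is_catalan w ->
  avoids [:: 1; 2; 0] w = pairwise (fun a b => a <= b.+1) w.
Proof.
move=> wC; rewrite avoids3 /same_order; apply/triplewiseP/(pairwiseP 0) => [Pw i j|Pw i j k].
  rewrite !inE => is_ js ij; rewrite leqNgt; apply/negP => wij.
  (* Since the word starts at 0, the letter one below the [i]-th occurs before it and plays the 1 of
     a pattern 120. *)
  have [|||h hi wh] := @catalan_ivt w 0 i (nth 0 w i).-1 wC;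
    rewrite ?catalan_nth0 //; first lia.
  have hi' : h < i by case: (eqVneq h i) wh => [->|]; lia.
  by move: (Pw h i j hi' ij js); lia.
move=> ij jk ks; have := Pw j k; rewrite !inE; lia.
Qed.

Definition no_valley (a b c : nat) : bool := (b < a) ==> (c <= b).

Lemma catalan_avoids101 (w : seq nat) : is_catalan w ->
  avoids [:: 1; 0; 1] w = triplewise no_valley w.
Proof.
move=> wC; rewrite avoids3 /same_order /no_valley.
apply/triplewiseP/triplewiseP => Pw i j k ij jk ks; last first.
  by move: (Pw i j k ij jk ks); lia.
apply/implyP => ji; rewrite leqNgt; apply/negP => kj.
(* The lower side of the valley reappears on the other slope: after [j] if it is the left one,
   before [i] if it is the right one. This gives two equal sides, hence 101. *)
have [ik|ki|ik] := ltngtP (nth 0 w i) (nth 0 w k).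
- have [|||h hjk wh] := @catalan_ivt w j k (nth 0 w i) wC; [lia|lia|lia|].
  have jh : j < h by case: (eqVneq h j) wh => [->|]; lia.
  by move: (Pw i j h ij jh); lia.
- have [|||h hi wh] := @catalan_ivt w 0 i (nth 0 w k) wC; rewrite ?catalan_nth0 //; try lia.
  have hj : h < j by lia.
  by move: (Pw h j k hj jk ks); lia.
by move: (Pw i j k ij jk ks); lia.
Qed.

(** * Enumeration by descents with an automaton *)

Lemma descents_cons2 (c a : nat) (v : seq nat) :
  descents (c :: a :: v) = (a < c) + descents (a :: v).
Proof.
rewrite /descents -!sum1_card.
under eq_bigl do rewrite inE.
under [in RHS]eq_bigl do rewrite inE.
by rewrite big_mkcond [in RHS]big_mkcond big_ord_recl.
Qed.

Lemma descents1 (c : nat) : descents [:: c] = 0.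
Proof. by rewrite /descents eq_card0 // => -[]. Qed.

(* After a prefix with last letter [c] and state [t], the admissible letters are
   those in the interval [lo c t, hi c t), and reading [a] updates the state to
   [upd c t a]. *)
Section Automaton.
Variables (T : Type) (lo hi : nat -> T -> nat) (upd : nat -> T -> nat -> T).

Fixpoint accepts (c : nat) (t : T) (v : seq nat) : bool :=
  if v is a :: v' then (lo c t <= a < hi c t) && accepts a (upd c t a) v'
  else true.

Fixpoint continuations (n c : nat) (t : T) : seq (seq nat) :=
  if n is n'.+1 then
    [seq a :: v | a <- index_iota (lo c t) (hi c t),
                  v <- continuations n' a (upd c t a)]
  else [:: [::]].

Lemma mem_continuations n c t v :
  (v \in continuations n c t) = (size v == n) && accepts c t v.
Proof.
elim: n c t v => [|n IHn] c t v /=; first by case: v.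
apply/allpairsPdep/andP => [[a [u [+ + ->]]]|[]].
  by rewrite mem_index_iota IHn /= eqSS => -> /andP[-> ->].
case: v => //= a v; rewrite eqSS => vn /andP[ac va].
by exists a, v; rewrite mem_index_iota IHn vn.
Qed.

Lemma uniq_continuations n c t : uniq (continuations n c t).
Proof.
elim: n c t => [|n IHn] c t //=.
apply: allpairs_uniq_dep; first exact: iota_uniq.
  by move=> a _; apply: IHn.
by move=> [a u] [b v] /= _ _ [-> ->].
Qed.

Local Open Scope ring_scope.

Definition continuation_gf (n c : nat) (t : T) : fps int :=
  \sum_(v <- continuations n c t) fpsX ^+ descents (c :: v).

Lemma continuation_gf0 c t : continuation_gf 0 c t = 1.
Proof. by rewrite /continuation_gf /= big_seq1 descents1. Qed.

Lemma continuation_gfS n c t : continuation_gf n.+1 c t =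
  \sum_(lo c t <= a < hi c t) fpsX ^+ (a < c)%N * continuation_gf n a (upd c t a).
Proof.
rewrite /continuation_gf /= big_allpairs_dep; apply: eq_bigr => a _.
by rewrite mulr_sumr; apply: eq_bigr => v _; rewrite descents_cons2 exprD.
Qed.

Lemma catalan_gf_automaton (p : seq nat) (t0 : T) :
  (forall v, is_catalan (0%N :: v) && avoids p (0%N :: v) = accepts 0 t0 v) ->
  forall n, fps_coef (catalan_gf p) n.+1 = continuation_gf n 0 t0.
Proof.
move=> pA n; apply/fpsP => k; rewrite /continuation_gf fps_coef_sum /=.
under eq_bigr do rewrite fps_coefXn.
rewrite -natr_sum -[LHS]natz; congr _%:R.
pose s := [seq 0%N :: v | v <- continuations n 0 t0 & descents (0%N :: v) == k].
transitivity (size s); last first.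
  by rewrite size_map size_filter -sum1_count big_mkcond; apply: eq_bigr => v _; case: eqP.
rewrite /catalan_count cardE -(size_map (@word_of n.+1)).
apply: perm_size; apply: uniq_perm.
- rewrite map_inj_uniq ?enum_uniq // => u v uv; apply: val_inj.
  exact: (inj_map val_inj uv).
- by rewrite map_inj_uniq ?filter_uniq ?uniq_continuations // => u v [].
move=> w; apply/mapP/mapP => [[u + ->]|[v + ->]].
  rewrite mem_enum !inE => /andP[uA ud].
  have: size (word_of u) = n.+1 by rewrite size_map size_tuple.
  case: (word_of u) uA ud => // a v /[dup] /andP[/= /andP[/eqP -> _] _].
  rewrite pA => vA vd [vn]; exists v => //.
  by rewrite mem_filter vd mem_continuations vn eqxx.
rewrite mem_filter mem_continuations -pA => /and3P[vd /eqP vn vA].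
(* Letters of a Catalan word of length [n.+1] are at most [n], so [inord] keeps their values. *)
have wn : size (map (@inord n) (0%N :: v)) == n.+1 by rewrite size_map /= vn.
have uv : word_of (Tuple wn) = 0%N :: v.
  rewrite /word_of /= inordK // -map_comp map_id_in // => a av /=.
  have /andP[/catalan_letter_bound /allP vB _] := vA.
  by rewrite inordK //; have := vB a; rewrite inE av orbT /= vn => ->.
by exists (Tuple wn); rewrite // mem_enum !inE uv vA.
Qed.

End Automaton.

Local Open Scope ring_scope.

(** * From the linear recurrences to the rational generating function *)

Lemma catalan_count0 (p : seq nat) k : p != [::] -> catalan_count p 0 k = (k == 0)%N.
Proof.
move=> p0; rewrite /catalan_count.
have w0 (w : 0.-tuple 'I_0) : word_of w = [::] by rewrite tuple0.
transitivity #|[set w : 0.-tuple 'I_0 | k == 0%N]|.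
  apply: eq_card => w; rewrite !inE w0 /descents eq_card0 => [|[]//].
  rewrite eq_sym andbC; case: eqP => //= _; apply/negP => /existsP[f _].
  by case: p p0 f => // a p _ f; case: (f ord0).
by case: eqP => _; rewrite cardsE ?card0 // card_tuple card_ord.
Qed.

Lemma solve_system (R : comUnitRingType) (x y z t : R) :
  1 - 3%:R * x + 2%:R * x ^+ 2 - x ^+ 2 * y \is a GRing.unit ->
  z = 1 + x * (z + t) -> t = 1 + x * (2%:R * t + y * z) ->
  1 + x * z = (1 - 2%:R * x + x ^+ 2 - x ^+ 2 * y) /
              (1 - 3%:R * x + 2%:R * x ^+ 2 - x ^+ 2 * y).
Proof.
move=> Du zE tE; apply: (canRL (mulrK Du)).
have z0 : z - (1 + x * (z + t)) = 0 by rewrite -zE subrr.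
have t0 : t - (1 + x * (2%:R * t + y * z)) = 0 by rewrite -tE subrr.
apply/eqP; rewrite -subr_eq0; apply/eqP.
(* Multiplying the equations by [1 - 2x] and [x] and adding eliminates [t]; the coefficient left on
   [z] is the determinant of the system, which is the denominator. *)
transitivity (x * ((1 - 2%:R * x) * (z - (1 + x * (z + t)))
  + x * (t - (1 + x * (2%:R * t + y * z))))); last by rewrite z0 t0 !mulr0 addr0 mulr0.
ring.
Qed.

Lemma catalan_gf_of_system (p : seq nat) (Z T : nat -> fps int) :
  p != [::] -> (forall n, fps_coef (catalan_gf p) n.+1 = Z n) ->
  Z 0 = 1 -> T 0 = 1 ->
  (forall n, Z n.+1 = Z n + T n) ->
  (forall n, T n.+1 = 2%:R * T n + fpsX * Z n) ->
  catalan_gf p =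
    (1 - 2%:R * fps2x + fps2x ^+ 2 - fps2x ^+ 2 * fps2y) /
    (1 - 3%:R * fps2x + 2%:R * fps2x ^+ 2 - fps2x ^+ 2 * fps2y).
Proof.
move=> p0 CZ Z0 T0 ZS TS.
rewrite -(@solve_system _ fps2x fps2y (Fps Z) (Fps T)).
- rewrite {1}[catalan_gf p]fps_shift; congr (fpsC _ + _ * _).
    by apply/fpsP => k; rewrite /= catalan_count0 //; case: k.
  by apply/fpsP => n; apply: CZ.
- suff -> : 1 - 3%:R * fps2x + 2%:R * fps2x ^+ 2 - fps2x ^+ 2 * fps2y =
      1 + fpsX * (- 3%:R + 2%:R * fps2x - fps2x * fps2y).
    exact: fps_unit_1Xl.
  by rewrite -/fps2x; ring.
- rewrite {1}[Fps Z]fps_shift; congr (_ + _ * _); first by rewrite /= Z0.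
  by apply/fpsP => n /=; rewrite ZS.
rewrite {1}[Fps T]fps_shift; congr (_ + _ * _); first by rewrite /= T0.
apply/fpsP => n; rewrite [LHS]/= TS mulr_natl mulr2n mulr_natl mulr2n.
by rewrite -[RHS]/(T n + T n + fps_coef (fps2y * _) n) fps_coef_mulC.
Qed.

(** * The pattern 120 *)

Definition lo120 (c l : nat) : nat := l.
Definition hi120 (c l : nat) : nat := c.+2.
(** From the initial state 0, the bound is always the largest letter read minus one, truncated at
    0. *)
Definition upd120 (c l a : nat) : nat := maxn l a.-1.

Lemma accepts120E c l v : accepts _ lo120 hi120 upd120 c l v =
  [&& path (fun u v => v <= u.+1)%N c v, all (leq l) v &
      pairwise (fun a b => a <= b.+1)%N v].
Proof.
elim: v c l => //= a v IHv c l; rewrite IHv /lo120 /hi120 /upd120 ltnS.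
have -> : all (leq (maxn l a.-1)) v = all (leq l) v && all (fun b => a <= b.+1)%N v.
  by rewrite -all_predI; apply: eq_all => b /=; lia.
case: (l <= a)%N; case: (a <= c.+1)%N => //=; rewrite ?andbF //.
by case: path => //=; case: (all (leq l) v).
Qed.

Definition gf120 := continuation_gf _ lo120 hi120 upd120.

Lemma catalan_gf120 n : fps_coef (catalan_gf [:: 1; 2; 0]%N) n.+1 = gf120 n 0%N 0%N.
Proof.
apply: catalan_gf_automaton => v; rewrite accepts120E.
have [vC|] := boolP (is_catalan (0%N :: v)); last by rewrite /= => /negbTE ->.
rewrite catalan_avoids120 //; move: vC => /= ->; rewrite andTb.
by rewrite (@eq_all _ _ predT) // (@eq_all _ (leq 0) predT) // !all_predT.
Qed.

(** From the start, the last letter exceeds the bound by 0 or 1 only; this lemma and the next treat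
    these two kinds of state. *)
Lemma gf120_low n l : gf120 n.+1 l l = gf120 n l l + gf120 n l.+1 l.
Proof.
rewrite /gf120 continuation_gfS /lo120 /hi120 /index_iota -addn2 addKn /= !big_cons big_nil.
rewrite /upd120 ltnn ltnNge leqnSn /= !mul1r addr0 maxnn.
by have /maxn_idPl -> : (l.-1 <= l)%N by exact: leq_pred.
Qed.

Lemma gf120_high n l :
  gf120 n.+1 l.+1 l = fpsX * gf120 n l l + gf120 n l.+1 l + gf120 n l.+2 l.+1.
Proof.
rewrite /gf120 continuation_gfS /lo120 /hi120 /index_iota -addn3 addKn /= !big_cons big_nil.
rewrite /upd120 ltnn ltnSn [(l.+2 < _)%N]ltnNge leqnSn /= expr1 !mul1r addr0 addrA maxnn.
have /maxn_idPl -> : (l.-1 <= l)%N by exact: leq_pred.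
by have /maxn_idPr -> : (l <= l.+1)%N by exact: leqnSn.
Qed.

(** Both recurrences commute with raising letter and bound together, so the two kinds of state go
    through one induction. *)
Lemma gf120_shift n l :
  gf120 n l l = gf120 n 0%N 0%N /\ gf120 n l.+1 l = gf120 n 1%N 0%N.
Proof.
elim: n l => [|n IHn] l; first by rewrite /gf120 !continuation_gf0.
rewrite !gf120_low !gf120_high.
by rewrite !(IHn l).1 !(IHn l).2 (IHn l.+1).2 (IHn 1%N).2.
Qed.

(** * The pattern 101 *)

Definition lo101 (c : nat) (d : bool) : nat := 0.
(** A rise, by 1, is allowed only while no descent has occurred. *)
Definition hi101 (c : nat) (d : bool) : nat := (c + ~~ d).+1.
Definition upd101 (c : nat) (d : bool) (a : nat) : bool := d || (a < c)%N.

Lemma accepts101_true c v :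
  accepts _ lo101 hi101 upd101 c true v = path geq c v.
Proof.
by elim: v c => //= a v IHv c; rewrite IHv /hi101 addn0 ltnS.
Qed.

Lemma accepts101_false c v : accepts _ lo101 hi101 upd101 c false v =
  path (fun u v => v <= u.+1)%N c v && triplewise no_valley (c :: v).
Proof.
have geq_tr : transitive geq by move=> a b c' /=; lia.
elim: v c => //= a v IHv c; rewrite /hi101 addn1 ltnS /upd101 /=.
rewrite -!andbA; case: (a <= c.+1)%N => //=.
(* After a descent from [c] to [a], avoiding valleys starting at [c] forces a weakly decreasing
   rest. If [c <= a], the triples starting at [c] are controlled by those starting at [a]. *)
have [ac|ca] := ltnP a c.
  rewrite accepts101_true; apply/idP/idP => [av|].
    have pv : pairwise geq (a :: v) by rewrite -sorted_pairwise.
    have /andP[/allP av' pv'] := pv.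
    have -> : path (fun u v => v <= u.+1)%N a v.
      by apply: sub_path av => x y /= ?; lia.
    have pw b : pairwise (no_valley b) v.
      by apply: sub_pairwise pv' => x y /= xy; apply/implyP.
    rewrite !pw /=; apply/andP; split.
      by apply/allP => b /av' ba; apply/implyP.
    by elim: v {av pv av' pw IHv} pv' => //= b v IHv /andP[_ pv];
       rewrite IHv // andbT; apply: sub_pairwise pv => x y /= xy; apply/implyP.
  move=> /and5P[_ /allP cav cv _ _].
  have av : all (geq a) v by apply/allP => b /cav; rewrite /no_valley ac.
  rewrite path_sortedE // av /= sorted_pairwise //.
  have: pairwise (no_valley c) v && all (geq a) v by rewrite cv av.
  elim: v {IHv cav cv av} => //= b v IHv /andP[/andP[/allP bv pv] /andP[ba av]].
  rewrite IHv ?pv // andbT; apply/allP => x /bv; rewrite /no_valley.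
  by move/implyP; apply; lia.
rewrite IHv /=; case: path => //=.
apply/andP/and4P => [[pa tv]|[_ _ pa tv]]; last by rewrite pa tv.
split=> //.
  by apply/allP => b _; rewrite /no_valley ltnNge ca.
apply: sub_pairwise pa => x y; rewrite /no_valley => /implyP h.
by apply/implyP => ?; apply: h; lia.
Qed.

Definition gf101 (d : bool) (n m : nat) : fps int :=
  continuation_gf _ lo101 hi101 upd101 n m d.

Lemma catalan_gf101 n :
  fps_coef (catalan_gf [:: 1; 0; 1]%N) n.+1 = gf101 false n 0.
Proof.
apply: catalan_gf_automaton => v; rewrite accepts101_false.
have [vC|] := boolP (is_catalan (0%N :: v)); last by rewrite /= => /negbTE ->.
by rewrite catalan_avoids101 //; move: vC => /= ->.
Qed.

Lemma gf101_falseS n m : gf101 false n.+1 m =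
  fpsX * \sum_(i < m) gf101 true n i + gf101 false n m + gf101 false n m.+1.
Proof.
rewrite {1}/gf101 continuation_gfS /lo101 /hi101 /upd101 addn1 big_mkord /=.
rewrite !big_ord_recr /= ltnn ltnNge leqnSn !mul1r; congr (_ + _ + _).
by rewrite mulr_sumr; apply: eq_bigr => i _; rewrite ltn_ord expr1.
Qed.

Lemma gf101_trueS n m : gf101 true n.+1 m =
  fpsX * \sum_(i < m) gf101 true n i + gf101 true n m.
Proof.
rewrite {1}/gf101 continuation_gfS /lo101 /hi101 /upd101 addn0 big_mkord /=.
rewrite !big_ord_recr /= ltnn !mul1r; congr (_ + _).
by rewrite mulr_sumr; apply: eq_bigr => i _; rewrite ltn_ord expr1.
Qed.

(** The difference in [n] is [fpsX] times a sum over the letters below the last one, so raising that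
    letter adds a single term. *)
Lemma gf101_true_succ n m : gf101 true n.+1 m.+1 - gf101 true n m.+1 =
  gf101 true n.+1 m - gf101 true n m + fpsX * gf101 true n m.
Proof. by rewrite !gf101_trueS big_ord_recr /=; ring. Qed.

(* In terms of generating functions in [x]: each additional level of the peak
   contributes an optional descent, i.e. a factor [1 + x y / (1 - x)]. *)
Lemma gf101_false_succ n m : gf101 false n.+1 m.+1 - gf101 false n m.+1 =
  gf101 false n.+1 m - gf101 false n m + fpsX * gf101 false n m.
Proof.
elim: n m => [|n IHn] m.
  rewrite !gf101_falseS /gf101 !continuation_gf0 big_ord_recr /= continuation_gf0.
  ring.
rewrite !(gf101_falseS n.+1).
have := IHn m; have := IHn m.+1.
have D0 : gf101 true n.+1 0 - gf101 true n 0 = 0.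
  by rewrite gf101_trueS big_ord0 mulr0 add0r subrr.
(* The term at 0 vanishes by [D0]; the others, shifted by one, are given by [gf101_true_succ]. *)
have : \sum_(i < m.+1) (gf101 true n.+1 i - gf101 true n i) =
   \sum_(i < m) (gf101 true n.+1 i - gf101 true n i + fpsX * gf101 true n i).
  rewrite big_ord_recl D0 add0r; apply: eq_bigr => i _.
  exact: gf101_true_succ.
rewrite [in RHS]big_split /= -mulr_sumr !sumrB => sE.
move=> H1 H0; move: (gf101_falseS n m) (gf101_falseS n m.+1) sE H1 H0.
move: (fpsX : fps int) (gf101 false n m) (gf101 false n m.+1) (gf101 false n m.+2)
  (gf101 false n.+1 m) (gf101 false n.+1 m.+1) (gf101 false n.+1 m.+2)
  (\sum_(i < m) gf101 true n i) (\sum_(i < m.+1) gf101 true n i)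
  (\sum_(i < m) gf101 true n.+1 i) (\sum_(i < m.+1) gf101 true n.+1 i).
move=> y b0 b1 b2 c0 c1 c2 s0 s1 t0 t1 /eqP + /eqP + /eqP + /eqP + /eqP.
rewrite -!(subr_eq0 _ (_ + _)) => /eqP E0 /eqP E1 /eqP Es /eqP E2 /eqP E3.
apply/eqP; rewrite -subr_eq0; apply/eqP.
(* The goal is a linear combination of the sum identity, the induction hypothesis at [m.+1] and [m],
   and the recurrence for [gf101 false n.+1] at [m.+1] and [m]. *)
transitivity (y * (t1 - s1 - (t0 - s0 + y * s0)) + (c2 - b2 - (c1 - b1 + y * b1))
  + (c1 - b1 - (c0 - b0 + y * b0)) - (c1 - (y * s1 + b1 + b2))
  + (1 - y) * (c0 - (y * s0 + b0 + b1))).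
  ring.
by rewrite E0 E1 Es E2 E3 !mulr0 !addr0.
Qed.

Theorem theorem8 (p : seq nat)
    (hp : p \in [:: [:: 1; 2; 0]; [:: 1; 0; 1]]%N) :
  let x := fps2x in
  let y := fps2y in
  catalan_gf p =
    (1 - 2%:R * x + x ^+ 2 - x ^+ 2 * y) /
    (1 - 3%:R * x + 2%:R * x ^+ 2 - x ^+ 2 * y).
Proof.
move: hp; rewrite !inE => /orP[] /eqP -> /=.
  apply: (@catalan_gf_of_system _ (fun n => gf120 n 0%N 0%N) (fun n => gf120 n 1%N 0%N)) => //.
  - exact: catalan_gf120.
  - exact: continuation_gf0.
  - exact: continuation_gf0.
  - by move=> n; rewrite gf120_low.
  (* The state with letter 2 and bound 1 is brought back to letter 1 and bound 0. *)
  by move=> n; rewrite gf120_high (gf120_shift n 1).2; ring.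
apply: (@catalan_gf_of_system _ (fun n => gf101 false n 0) (fun n => gf101 false n 1)) => //.
- exact: catalan_gf101.
- exact: continuation_gf0.
- exact: continuation_gf0.
- by move=> n; rewrite gf101_falseS big_ord0 mulr0 add0r.
(* At [m = 0] the right-hand difference is [gf101 false n 1], which gives the second copy of
   [T n]. *)
move=> n; have /eqP := gf101_false_succ n 0; rewrite subr_eq => /eqP ->.
by rewrite gf101_falseS big_ord0; ring.
Qed.
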